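(* Let $0\le a\le b$ be fixed constants and consider the composite proportion-based reward function $$R(\mathcal I,i)=1(i\in\mathcal I)-a\max\bigl(|\mathcal I_{k(i)}|-1,0\bigr)-b\bigl(|\mathcal I|-|\mathcal I_{k(i)}|\bigr),\qquad \mathcal I\subset\mathcal N,\ i\in\mathcal N.$$ Then for each $z\in\mathcal Z$ the optimal classifier for $R$ is the composite classifier $\hat I(z)=\hat I_{\mathbf m(z)}$ with $\mathbf m(z)=(m_1(z),\ldots,m_K(z))$, where for $k=1,\ldots,K$ $$m_k(z)=\operatorname*{arg\,max}_{0\le m_k\le N_k}\bigl[v_k(m_k;z)-aP_k\max(m_k-1,0)-b(1-P_k)m_k\bigr]=\max\{m_k'(z),m_k''(z)\},$$ with $$m_k'(z)=1\bigl(p_{(kN_k)}\ge(1-P_k)b\bigr),$$ $$m_k''(z)=\max\{2\le m_k\le N_k:\ p_{(k,N_k+1-m_k)}\ge P_ka+(1-P_k)b\},$$ and the convention $\max\emptyset=-\infty$ in the definition of $m_k''(z)$. Here $P_k=P_k(z)=\sum_{i\in\mathcal N_k}p_i$, $v_k(0;z)=0$ and $v_k(m_k;z)=\sum_{j=1}^{m_k}p_{(k,N_k+1-j)}$ for $1\le m_k\le N_k$.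
   Context: Let $N\ge 1$ and $\mathcal N=\{1,\ldots,N\}$ be a finite set of categories. The true category $I$ is a random variable with prior $\pi_i=P(I=i)$, $i\in\mathcal N$. Conditionally on $I=i$, the observation $Z\in\mathcal Z$ has density (or probability function) $f_i$. The posterior probabilities given $Z=z$ are $p_i=p_i(z)=P(I=i\mid Z=z)=\pi_if_i(z)/\sum_{j=1}^N\pi_jf_j(z)$ (the denominator being positive). The categories are partitioned into $K$ blocks $\mathcal N_1,\ldots,\mathcal N_K$ of sizes $N_1,\ldots,N_K\ge1$, $\sum_kN_k=N$, where $\mathcal N_k=\{i:\sum_{l=1}^{k-1}N_l+1\le i\le\sum_{l=1}^kN_l\}$. For $i\in\mathcal N$, $k(i)$ is the block index with $i\in\mathcal N_{k(i)}$, and for $\mathcal I\subset\mathcal N$, $\mathcal I_k=\mathcal I\cap\mathcal N_k$. Within each block the posterior probabilities $p_i$, $i\in\mathcal N_k$, are ordered as $p_{(k1)}\le\cdots\le p_{(kN_k)}$ (also written $p_{(k,j)}$), and $(kj)$ denotes the category of block $k$ whose posterior probability is $p_{(kj)}$ (ties broken in some fixed way, so that $(k1),\ldots,(kN_k)$ enumerates $\mathcal N_k$). A classifier assigns to each $z\in\mathcal Z$ a subset $\hat I(z)\subset\mathcal N$ (the empty set and all of $\mathcal N$ are allowed). A reward function $R(\mathcal I,i)$ is a real number for each $\mathcal I\subset\mathcal N$ and $i\in\mathcal N$. The value function is $V(z;\mathcal I)=E[R(\mathcal I,I)\mid Z=z]=\sum_{i=1}^NR(\mathcal I,i)\,p_i(z)$.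 The optimal (Bayes) classifier for $R$ is $\hat I(z)=\operatorname{arg\,max}_{\mathcal I\subset\mathcal N}V(z;\mathcal I)$ for each $z$. Here $\operatorname{arg\,max}$ means a point at which the maximum is attained (not necessarily unique); an equality ''$\operatorname{arg\,max}=x$'' means that the maximum is attained at $x$. For $\mathbf m=(m_1,\ldots,m_K)\in\prod_{k=1}^K\{0,\ldots,N_k\}$ the composite classifier is $\hat I_{\mathbf m}=\{(kj):1\le k\le K,\ N_k+1-m_k\le j\le N_k\}$, i.e. it contains the $m_k$ categories with largest posterior probabilities from block $k$, for each $k$. $1(\cdot)$ is the indicator function and $|\cdot|$ denotes cardinality. *)

(* Defs.v *)
From HB Require Import structures.
From mathcomp Require Import all_boot all_order all_algebra.
From mathcomp Require Import all_classical all_reals all_analysis.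

Set Implicit Arguments.
Unset Strict Implicit.
Unset Printing Implicit Defensive.

Import Order.TTheory GRing.Theory Num.Theory.

Local Open Scope ring_scope.

(* Categories and blocks are numbered from 0, so category c stands for the
   category c + 1 of the usual numbering 1, ..., N with N = N_1 + ... + N_K;
   ranks j inside a block keep the usual numbering 1, ..., N_k. *)
Notation category sz := 'I_(\sum_k sz k)%N.

Definition block K (sz : 'I_K -> nat) (k : 'I_K) : {set category sz} :=
  [set i : category sz | (\sum_(l < K | (l < k)%N) sz l <= i
                          < \sum_(l < K | (l <= k)%N) sz l)%N].

Definition block_index K (sz : 'I_K -> nat) (i : category sz) : 'I_K :=
  tagnat.sig1 i.

Lemma mem_block K (sz : 'I_K -> nat) (k : 'I_K) (i : category sz) :
  (i \in block sz k) = (block_index i == k).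
Proof.
have le_sum (m : 'I_K) : (\sum_(l < K | (l <= m)%N) sz l =
    \sum_(l < K | (l < m)%N) sz l + sz m)%N.
  rewrite (bigD1 m) //= addnC; congr (_ + _)%N.
  by apply: eq_bigl => l; rewrite ltn_neqAle andbC.
have mono (m n : 'I_K) : (m < n)%N -> (\sum_(l < K | (l <= m)%N) sz l <=
    \sum_(l < K | (l < n)%N) sz l)%N.
  move=> mn; rewrite [leqRHS](bigID [pred l : 'I_K | (l <= m)%N]) /=.
  rewrite (eq_bigl (fun l : 'I_K => (l < n)%N && (l <= m)%N)) ?leq_addr //.
  move=> l /=; case: (leqP l m) => //; rewrite ?andbF // andbT.
  by move=> lm; rewrite (leq_ltn_trans lm mn).
have /andP[lo hi] : (\sum_(l < K | (l < block_index i)%N) sz l <= i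
    < \sum_(l < K | (l <= block_index i)%N) sz l)%N.
  rewrite le_sum; have e : i = _ :> nat := tagnat.rect i.
  by apply/andP; split; rewrite e ?leq_addr // ltn_add2l ltn_ord.
rewrite inE; case: eqVneq => [<-|]; first by rewrite lo hi.
rewrite -val_eqE /= neq_ltn => /orP[] /mono h.
- by rewrite leqNgt (leq_trans hi h).
- by rewrite andbC ltnNge (leq_trans h lo).
Qed.

Definition maximizer (R : realType) (S : Type) (F : S -> R) (x : S) : Prop :=
  forall y, F y <= F x.

Section Model.
Local Open Scope classical_set_scope.
Context {R : realType} {d d' : measure_display}.
Context {Omega : measurableType d} {T : measurableType d'}.
Context {N : nat}.

Definition prior (P : probability Omega R) (I : Omega -> 'I_N) (i : 'I_N) : R :=
  fine (P (I @^-1` [set i])).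

(* The reference measure mu is arbitrary: mu = Lebesgue measure gives
   probability densities, mu = counting measure gives probability functions.
   The last field says that, conditionally on I = i, Z has density f i, in a
   form that is also meaningful when the prior of i vanishes. *)
Record classification_model (P : probability Omega R)
    (mu : {measure set T -> \bar R})
    (I : Omega -> 'I_N) (Z : Omega -> T) (f : 'I_N -> T -> R) : Prop := {
  category_measurable : forall i, measurable (I @^-1` [set i]);
  observation_measurable : measurable_fun [set: Omega] Z;
  density_measurable : forall i, measurable_fun [set: T] (f i);
  density_ge0 : forall i z, 0 <= f i z;
  density_integral : forall i, (\int[mu]_z (f i z)%:E = 1)%E;
  conditional_density : forall i (B : set T), measurable B ->
    (P (I @^-1` [set i] `&` Z @^-1` B) =
     (prior P I i)%:E * \int[mu]_(z in B) (f i z)%:E)%E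
}.

Definition evidence (pi : 'I_N -> R) (f : 'I_N -> T -> R) (z : T) : R :=
  \sum_j pi j * f j z.

Definition posterior (pi : 'I_N -> R) (f : 'I_N -> T -> R) (z : T)
    (i : 'I_N) : R :=
  pi i * f i z / evidence pi f z.

(* E[Rw(J, I) | Z = z], with p the posterior distribution given Z = z. *)
Definition value (p : 'I_N -> R) (Rw : {set 'I_N} -> 'I_N -> R)
    (J : {set 'I_N}) : R :=
  \sum_i Rw J i * p i.

End Model.

Section Blocks.
Context {R : realType} {K : nat} (sz : 'I_K -> nat).

Definition composite_reward (a b : R) (J : {set category sz})
    (i : category sz) : R :=
  let Jk := J :&: block sz (block_index i) in
  (i \in J)%:R - a * Num.max (#|Jk|%:R - 1) 0 - b * (#|J|%:R - #|Jk|%:R).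

(* s j is the category (kj), 1 <= j <= N_k; any way of breaking ties is
   allowed, and values of s outside this range are irrelevant. *)
Definition orders_block (p : category sz -> R) (k : 'I_K)
    (s : nat -> category sz) : Prop :=
  let ranks := [pred j | (1 <= j <= sz k)%N] in
  [/\ {in ranks &, injective s},
      forall i, i \in block sz k <-> exists2 j, j \in ranks & s j = i
    & {in ranks &, forall j j', (j <= j')%N -> p (s j) <= p (s j')}].

Definition composite_classifier (s : 'I_K -> nat -> category sz)
    (m : forall k : 'I_K, 'I_(sz k).+1) : {set category sz} :=
  [set i | [exists k : 'I_K, [exists j : 'I_(sz k).+1,
     (sz k + 1 - m k <= j)%N && (s k j == i)]]].

Definition block_prob (p : category sz -> R) (k : 'I_K) : R :=
  \sum_(i in block sz k) p i.

Definition top_sum (p : category sz -> R) (k : 'I_K)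
    (s : nat -> category sz) (m : nat) : R :=
  \sum_(1 <= j < m.+1) p (s (sz k + 1 - j)%N).

Definition block_objective (a b : R) (p : category sz -> R) (k : 'I_K)
    (s : nat -> category sz) (m : nat) : R :=
  top_sum p k s m - a * block_prob p k * Num.max (m%:R - 1) 0
  - b * (1 - block_prob p k) * m%:R.

Definition size' (b : R) (p : category sz -> R) (k : 'I_K)
    (s : nat -> category sz) : \bar R :=
  ((1 - block_prob p k) * b <= p (s (sz k)))%R%:R%:E.

(* Extended-real valued because the maximum of the empty set is -oo. *)
Definition size'' (a b : R) (p : category sz -> R) (k : 'I_K)
    (s : nat -> category sz) : \bar R :=
  \big[maxe/-oo%E]_(2 <= m < (sz k).+1 |
      block_prob p k * a + (1 - block_prob p k) * b
        <= p (s (sz k + 1 - m)%N)) m%:R%:E.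

End Blocks.

(* Main.v *)
Require Import Defs.
From HB Require Import structures.
From mathcomp Require Import all_boot all_order all_algebra.
From mathcomp Require Import all_classical all_reals all_analysis.
From mathcomp Require Import lra zify.

Set Implicit Arguments.
Unset Strict Implicit.
Unset Printing Implicit Defensive.

Import Order.TTheory GRing.Theory Num.Theory.

Local Open Scope ring_scope.

(** Fix z and write p for the posterior, P_k for the posterior probability of
    block k and J_k for the part of J in block k. Since the P_k add up to 1,
    the value of a set J splits into one term for each block
    (value_composite_reward), namely
      sum_(i in J_k) p_i - a P_k max(|J_k| - 1, 0) - b (1 - P_k) |J_k|,
    and the blocks can be optimized separately. For a given size of J_k only
    the posterior mass of J_k matters, and it is largest for the most probable
    categories of the block (sum_le_top_sum). What remains is to choose the
    size in each block.

    Going from n to n + 1 categories in block k earns the (n+1)-st largest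
    posterior probability and costs (1 - P_k) b if n = 0 and
    P_k a + (1 - P_k) b if n >= 1. Gains do not increase with n and, as a and
    P_k are nonnegative, costs do not decrease, so the favourable steps form an initial
    segment and the objective is maximal at its end (optimal_size). That end
    is the maximum of the two threshold sizes (maxe_size). *)

Lemma unimodal_le_peak (R : realType) (F : nat -> R) (m N : nat) :
  (m <= N)%N ->
  (forall n, (n < m)%N -> F n <= F n.+1) ->
  (forall n, (m <= n < N)%N -> F n.+1 <= F n) ->
  forall n, (n <= N)%N -> F n <= F m.
Proof.
move=> mN up down n nN; case: (leqP n m) => [nm|/ltnW mn].
- apply: (@homo_leq_in _ [pred i | (i <= m)%N] F (fun x y => x <= y)) => //.
  + by move=> ? ? ?; exact: le_trans.
  + by move=> i j _ jm l /andP[_ /ltnW lj]; exact: leq_trans lj jm.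
  + by move=> i _ im; exact: up.
  + exact: leqnn.
- apply: (@homo_leq_in _ [pred i | (m <= i <= N)%N] F (fun x y => y <= x)) => //.
  + by move=> x y t xy /le_trans; apply.
  + move=> i j /andP[mi _] /andP[_ jN] l /andP[/ltnW il /ltnW lj].
    by rewrite inE (leq_trans mi il) (leq_trans lj jN).
  + by move=> i /andP[mi _] /andP[_ iN]; apply: down; rewrite mi.
  + by rewrite inE leqnn.
  + by rewrite inE mn.
Qed.

(** The size m is the least non-member of q below N, or N. With q the test that
    one more category is worth its cost, m is the optimal number of
    categories. *)
Lemma initial_segment_size (q : pred nat) (N : nat) :
  (forall i j, (i <= j < N)%N -> q j -> q i) ->
  exists2 m, (m <= N)%N & forall n, (n < N)%N -> q n = (n < m)%N.
Proof.
move=> qdown; have ex : exists n, (N <= n)%N || ~~ q n by exists N; rewrite leqnn.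
case: (ex_minnP ex) => m hm minm.
exists m => [|n nN]; first by apply: minm; rewrite leqnn.
case: ltnP => [nm|mn].
- by apply: contraTT nm => nq; rewrite -leqNgt minm // nq orbT.
- move: hm; rewrite leqNgt (leq_ltn_trans mn nN) /=.
  by apply: contraNF; apply: qdown; rewrite mn.
Qed.

Lemma sum_posterior (R : realType) (N : nat) (pi : 'I_N -> R)
    d (S : measurableType d) (f : 'I_N -> S -> R) z :
  evidence pi f z != 0 -> \sum_i posterior pi f z i = 1.
Proof. by move=> ev0; rewrite -mulr_suml divff. Qed.

Lemma posterior_ge0 (R : realType) (N : nat) (pi : 'I_N -> R)
    d (S : measurableType d) (f : 'I_N -> S -> R) z i :
  (forall j, 0 <= pi j) -> (forall j, 0 <= f j z) -> 0 <= posterior pi f z i.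
Proof.
move=> pi0 f0; apply: divr_ge0; first exact: mulr_ge0.
by apply: sumr_ge0 => j _; exact: mulr_ge0.
Qed.

(** * The most probable categories of one block *)

Section OneBlock.
Context {R : realType} {K : nat} (sz : 'I_K -> nat) (p : category sz -> R).
Variables (k : 'I_K) (s : nat -> category sz).
Hypothesis hs : orders_block p k s.

(** Indexed from the top: i = 0 is the most probable category of the block, so
    that categories are added one by one as m grows. *)
Definition top_set (m : nat) : {set category sz} :=
  [set s (sz k - i)%N | i : 'I_m].

Lemma top_rank m n : (m <= sz k)%N -> (n < m)%N -> (1 <= sz k - n <= sz k)%N.
Proof. by move=> mk nm; rewrite subn_gt0 (leq_trans nm mk) leq_subr. Qed.

Lemma top_set_inj m : (m <= sz k)%N ->
  injective (fun i : 'I_m => s (sz k - i)%N).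
Proof.
case: hs => sinj _ _ mk i j eq_s; apply: ord_inj.
have : (sz k - i = sz k - j)%N.
  by apply: sinj => //; rewrite inE (top_rank mk).
by move/eqP; rewrite eqn_sub2lE ?(leq_trans (ltnW (ltn_ord _)) mk) // => /eqP.
Qed.

Lemma card_top_set m : (m <= sz k)%N -> #|top_set m| = m.
Proof. by move=> mk; rewrite card_imset ?card_ord //; exact: top_set_inj. Qed.

Lemma top_sumE m : top_sum p k s m = \sum_(i < m) p (s (sz k - i)%N).
Proof.
rewrite /top_sum big_add1 /= big_mkord.
by apply: eq_bigr => i _; rewrite addn1 subSS.
Qed.

Lemma sum_top_set m : (m <= sz k)%N ->
  \sum_(i in top_set m) p i = top_sum p k s m.
Proof.
move=> mk; rewrite top_sumE big_imset /=; first by apply: eq_bigl.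
by move=> i j _ _; exact: top_set_inj.
Qed.

Lemma card_block : #|block sz k| = sz k.
Proof.
rewrite -(card_top_set (leqnn _)); congr #|pred_of_set _|.
case: hs => _ mem _; apply/setP => i; apply/idP/imsetP.
- move=> /mem[j /andP[j1 jk] <-].
  have lt : (sz k - j < sz k)%N by rewrite ltn_subrL j1 (leq_trans j1).
  by exists (Ordinal lt) => //=; rewrite subKn.
- move=> [j _ ->]; apply/mem; exists (sz k - j)%N => //.
  exact: (top_rank (leqnn _)).
Qed.

Lemma top_p_decreasing i j : (i <= j < sz k)%N ->
  p (s (sz k - j)%N) <= p (s (sz k - i)%N).
Proof.
case: hs => _ _ mono /andP[ij jk]; apply: mono.
- exact: (top_rank (leqnn _)).
- exact: (top_rank (leqnn _) (leq_ltn_trans ij jk)).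
- exact: leq_sub2l.
Qed.

(** Among the subsets of a block with a given size, the most probable
    categories have the largest posterior mass. Subtract from every posterior
    probability the smallest one, t, in the top set of that size: the
    differences are >= 0 inside the top set and <= 0 in the rest of the block,
    so that the inequality holds term by term; since both sets have the same
    size, the same multiple of t has been subtracted on both sides. *)
Lemma sum_le_top_sum (J : {set category sz}) : J \subset block sz k ->
  \sum_(i in J) p i <= top_sum p k s #|J|.
Proof.
move=> Jk; have nk : (#|J| <= sz k)%N by rewrite -card_block subset_leq_card.
rewrite -(sum_top_set nk); set A := top_set _.
case: (eqVneq J finset.set0) => [J0|].
  by rewrite /A J0 cards0 (sum_top_set (leq0n _)) top_sumE big_ord0
    finset.big_set0.
rewrite -card_gt0 => n0; have n1 : (#|J|.-1 < #|J|)%N by rewrite prednK.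
set t := p (s (sz k - #|J|.-1)%N).
suff : \sum_(i in J) (p i - t) <= \sum_(i in A) (p i - t).
  by rewrite !sumrB !sumr_const (card_top_set nk) lerD2r.
rewrite big_mkcond [leRHS]big_mkcond; apply: ler_sum => i _.
have out : i \in J -> i \notin A -> p i <= t.
  case: hs => _ mem _ /(fintype.subsetP Jk)/mem[j /andP[j1 jk] <-] jA.
  rewrite -(subKn jk); apply: top_p_decreasing.
  rewrite ltn_subrL j1 (leq_trans j1 jk) andbT.
  rewrite (leq_trans (leq_pred _)) // leqNgt; apply: contra jA => lt.
  by apply/imsetP; exists (Ordinal lt) => //=; rewrite subKn.
have inA : i \in A -> t <= p i.
  move=> /imsetP[j _ ->]; apply: top_p_decreasing.
  by rewrite (leq_trans n1 nk) andbT -ltnS prednK.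
case: (boolP (i \in J)) => iJ; case: (boolP (i \in A)) => iA //.
- by rewrite subr_le0 out.
- by rewrite subr_ge0 inA.
Qed.

(** * The optimal number of categories in one block *)

(** The increase of the penalty when a category is added to n categories of
    the block. The block term a is charged only from the second category on,
    which is why the two thresholds of the theorem differ. *)
Definition marginal_cost (a b : R) (n : nat) : R :=
  (0 < n)%N%:R * (block_prob p k * a) + (1 - block_prob p k) * b.

Lemma block_objectiveS a b n : block_objective a b p k s n.+1 =
  block_objective a b p k s n + (p (s (sz k - n)%N) - marginal_cost a b n).
Proof.
rewrite /block_objective !top_sumE big_ord_recr /= /marginal_cost.
have -> : Num.max (n.+1%:R - 1) 0 = n%:R :> R.
  by rewrite -natr1 addrK; apply/max_idPl.
have -> : Num.max (n%:R - 1) 0 = n%:R - (0 < n)%N%:R :> R.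
  case: n => [|n] /=; first by rewrite sub0r subr0; apply/max_idPr; lra.
  by apply/max_idPl; rewrite subr_ge0 ler1n.
by rewrite -natr1; lra.
Qed.

(** The threshold in size' is the cost of the first addition, and the one in
    size'' is the cost of every later addition. If exactly the first m
    additions are worth their cost, then size'' is m for m >= 2, while for
    m <= 1 it is a maximum over the empty set and size' decides. *)
Lemma maxe_size a b m : (m <= sz k)%N -> (1 <= sz k)%N ->
  (forall n, (n < sz k)%N ->
     (marginal_cost a b n <= p (s (sz k - n)%N)) = (n < m)%N) ->
  maxe (size' b p k s) (size'' a b p k s) = m%:R%:E.
Proof.
move=> mk k1 hm; rewrite /size' /size''.
have -> : ((1 - block_prob p k) * b <= p (s (sz k)))%R = (0 < m)%N.
  by rewrite -(hm 0%N) // /marginal_cost mul0r add0r subn0.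
rewrite (_ : \big[_/_]_(_ <= _ < _ | _) _ =
    \big[maxe/-oo%E]_(2 <= n < (sz k).+1 | (n <= m)%N) n%:R%:E); last first.
  rewrite big_nat_cond [RHS]big_nat_cond; apply: eq_bigl => -[|[|n]] //=.
  case nk: (n.+2 < _)%N => //=.
  by rewrite -(hm n.+1) // /marginal_cost mul1r addn1 subSS.
apply/eqP; rewrite eq_le ge_max; apply/andP; split; first apply/andP; first split.
- by rewrite lee_fin ler_nat; case: (m).
- apply: (big_ind (fun x => (x <= m%:R%:E)%E)) => [|x y xm ym|n nm].
  + exact: leNye.
  + by rewrite ge_max xm.
  + by rewrite lee_fin ler_nat.
- rewrite le_max; case: (leqP m 1) => m1; apply/orP; [left|right].
  + by rewrite lee_fin ler_nat; case: (m) m1 => [|[]].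
  + apply: (le_bigmax_seq _ m (fun n => n <= m)%N
      (fun n : nat => n%:R%:E : \bar R)) => //.
    by rewrite mem_index_iota m1 ltnS.
Qed.

Lemma marginal_cost_nondecreasing a b i j :
  0 <= a -> 0 <= block_prob p k -> (i <= j)%N ->
  marginal_cost a b i <= marginal_cost a b j.
Proof.
move=> a0 P0 ij; rewrite lerD2r; apply: ler_wpM2r; first exact: mulr_ge0.
by rewrite ler_nat; case: i j ij => [|i] [|j].
Qed.

(** As categories are added, the gain p does not increase and the marginal
    cost does not decrease, so additions are favourable up to some size and unfavourable after
    it: the objective is unimodal, with its peak where the thresholds stop
    being met. *)
Lemma optimal_size a b :
  0 <= a -> 0 <= block_prob p k -> (1 <= sz k)%N ->
  exists m : 'I_(sz k).+1,
    maximizer (fun n : 'I_(sz k).+1 => block_objective a b p k s n) m /\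
    m%:R%:E = maxe (size' b p k s) (size'' a b p k s).
Proof.
move=> a0 P0 k1.
have [i j ijk /= qj|m mk hm] := @initial_segment_size
    (fun n => marginal_cost a b n <= p (s (sz k - n)%N)) (sz k).
  apply: le_trans (top_p_decreasing ijk); apply: le_trans qj.
  by apply: marginal_cost_nondecreasing => //; case/andP: ijk.
exists (Ordinal (mk : (m < (sz k).+1)%N)); split; last by rewrite (maxe_size mk).
move=> n; apply: (unimodal_le_peak mk) => /= [i im|i /andP[mi ik]|].
- by rewrite block_objectiveS lerDl subr_ge0 hm // (leq_trans im mk).
- rewrite block_objectiveS gerDl subr_le0 ltW // ltNge hm //.
  by rewrite -leqNgt.
- by rewrite -ltnS.
Qed.

End OneBlock.

(** * The value as a sum over blocks *)

Lemma sum_by_block (R : realType) (K : nat) (sz : 'I_K -> nat)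
    (F : category sz -> R) :
  \sum_i F i = \sum_k \sum_(i in block sz k) F i.
Proof.
rewrite (partition_big (@block_index K sz) predT) //.
by apply: eq_bigr => k _; apply: eq_bigl => i; rewrite mem_block.
Qed.

(** The penalty b (|J| - |J_k(i)|) couples the blocks, but its posterior mean
    does not: the block probabilities P_k add up to 1, hence
    |J| - sum_k P_k |J_k| = sum_k (1 - P_k) |J_k|. *)
Lemma value_composite_reward (R : realType) (K : nat) (sz : 'I_K -> nat)
    (p : category sz -> R) (a b : R) (J : {set category sz}) :
  \sum_i p i = 1 ->
  value p (composite_reward a b) J =
  \sum_k (\sum_(i in J :&: block sz k) p i
    - a * block_prob p k * Num.max (#|J :&: block sz k|%:R - 1) 0
    - b * (1 - block_prob p k) * #|J :&: block sz k|%:R).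
Proof.
move=> p1; pose P := block_prob p; pose n k := #|J :&: block sz k|%:R : R.
have sumP : \sum_k P k = 1 by rewrite -p1 sum_by_block.
have sumn : \sum_k n k = #|J|%:R.
  rewrite -sum1_card natr_sum [RHS]big_mkcond [RHS]sum_by_block.
  apply: eq_bigr => k _.
  rewrite /n -sum1_card natr_sum big_mkcond [RHS]big_mkcond.
  by apply: eq_bigr => i _; rewrite finset.in_setI andbC; case: (i \in block sz k).
(* The added terms b n_k - b |J| P_k cancel in the sum over k; with them the
   identity holds block by block. *)
transitivity (\sum_k ((\sum_(i in J :&: block sz k) p i
    - a * P k * Num.max (n k - 1) 0 - b * (1 - P k) * n k)
    + (b * n k - b * #|J|%:R * P k))); last first.
  rewrite big_split /= -[RHS]addr0; congr (_ + _).
  by rewrite sumrB -!mulr_sumr sumP sumn mulr1 subrr.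
rewrite /value sum_by_block; apply: eq_bigr => k _.
transitivity (\sum_(i in block sz k) (i \in J)%:R * p i
    - (a * Num.max (n k - 1) 0 + b * (#|J|%:R - n k)) * P k).
  rewrite /P /block_prob mulr_sumr -sumrB; apply: eq_bigr => i.
  rewrite mem_block => /eqP ik; rewrite /composite_reward ik -/(n k); lra.
have -> : \sum_(i in block sz k) (i \in J)%:R * p i =
    \sum_(i in J :&: block sz k) p i.
  rewrite big_mkcond [RHS]big_mkcond; apply: eq_bigr => i _.
  by rewrite finset.in_setI andbC; case: (i \in block sz k); case: (i \in J);
    rewrite /= ?mul1r ?mul0r.
lra.
Qed.

Lemma composite_classifier_block (R : realType) (K : nat) (sz : 'I_K -> nat)
    (p : category sz -> R) (s : 'I_K -> nat -> category sz)
    (hs : forall k, orders_block p k (s k))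
    (m : forall k : 'I_K, 'I_(sz k).+1) (k : 'I_K) :
  composite_classifier s m :&: block sz k = top_set k (s k) (m k).
Proof.
have mk : (m k <= sz k)%N by rewrite -ltnS.
apply/setP => i; rewrite finset.in_setI mem_block inE; apply/andP/imsetP.
- move=> [/existsP[k' /existsP[j /andP[lej /eqP sj]]] /eqP ik].
  have mk' : (m k' <= sz k')%N by rewrite -ltnS.
  have j1 : (1 <= j <= sz k')%N.
    by rewrite -[X in _ && X]ltnS ltn_ord (leq_trans _ lej) // addn1 subn_gt0.
  have ek : k = k'.
    case: (hs k') => _ mem _; rewrite -ik; apply/eqP; rewrite -mem_block.
    by apply/mem; exists (j : nat).
  subst k'; have lt : (sz k - j < m k)%N.
    by move: lej j1 mk; clear; lia.
  by exists (Ordinal lt); rewrite //= subKn ?sj //; case/andP: j1.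
- move=> [j _ ->]; case: (hs k) => _ mem _.
  have rk := top_rank mk (ltn_ord j); split.
    apply/existsP; exists k; apply/existsP.
    have lt : (sz k - j < (sz k).+1)%N by rewrite ltnS leq_subr.
    exists (Ordinal lt); rewrite /= eqxx andbT.
    by move: (ltn_ord j) mk; clear; lia.
  by rewrite -mem_block; apply/mem; exists (sz k - j)%N.
Qed.

(** * Optimality of the composite classifier *)

Theorem corollary3 (R : realType) (d d' : measure_display)
    (Omega : measurableType d) (T : measurableType d')
    (K : nat) (sz : 'I_K -> nat)
    (hsz : forall k, (1 <= sz k)%N) (hN : (1 <= \sum_k sz k)%N)
    (P : probability Omega R) (mu : {measure set T -> \bar R})
    (I : Omega -> category sz) (Z : Omega -> T) (f : category sz -> T -> R)
    (hmodel : classification_model P mu I Z f)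
    (a b : R) (ha : 0 <= a) (hab : a <= b)
    (z : T) (hz : 0 < evidence (prior P I) f z)
    (s : 'I_K -> nat -> category sz)
    (hs : forall k, orders_block (posterior (prior P I) f z) k (s k)) :
  let p := posterior (prior P I) f z in
  exists m : forall k : 'I_K, 'I_(sz k).+1,
    [/\ forall k, maximizer
          (fun n : 'I_(sz k).+1 => block_objective a b p k (s k) n) (m k),
        forall k,
          (m k)%:R%:E = maxe (size' b p k (s k)) (size'' a b p k (s k))
      & maximizer (value p (composite_reward a b)) (composite_classifier s m)].
Proof.
move=> p; case: hmodel => _ _ _ f0 _ _.
have p1 : \sum_i p i = 1 by apply: sum_posterior; rewrite gt_eqF.
have p0 i : 0 <= p i by apply: posterior_ge0 => // j; rewrite fine_ge0.
have P0 k : 0 <= block_prob p k by apply: sumr_ge0.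
have opt k := cid (optimal_size (hs k) b ha (P0 k) (hsz k)).
pose m k := sval (opt k); exists m.
have mopt k := svalP (opt k).
split=> [k|k|J]; [exact: (mopt k).1|exact: (mopt k).2|].
rewrite !value_composite_reward //; apply: ler_sum => k _.
have mk : (m k <= sz k)%N by rewrite -ltnS.
rewrite (composite_classifier_block hs) (sum_top_set (hs k)) //.
rewrite (card_top_set (hs k)) //.
have Jk : J :&: block sz k \subset block sz k by apply: finset.subsetIr.
have nk : (#|J :&: block sz k| < (sz k).+1)%N.
  by rewrite ltnS -(card_block (hs k)) subset_leq_card.
apply: le_trans ((mopt k).1 (Ordinal nk)).
by rewrite /block_objective /= !lerD2r (sum_le_top_sum (hs k)).
Qed.
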